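(* Let $(A,\circ,B(\cdot,\cdot))$ be a quadratic Novikov algebra over $\mathbf{k}$. Then there exists a positive integer $r$ such that $A=\bigoplus_{i=1}^r A_i$, where (1) $A_i$ is a nondegenerate ideal of $(A,\circ,B(\cdot,\cdot))$ for each $i$; (2) $A_i$ contains no nontrivial nondegenerate ideal of $(A,\circ,B(\cdot,\cdot))$ for each $i$; (3) for all $i\neq j$, $A_i$ and $A_j$ are orthogonal, i.e. $B(A_i,A_j)=0$.
   Context: $\mathbf{k}$ is a field of characteristic zero; all vector spaces and algebras are finite-dimensional over $\mathbf{k}$. A Novikov algebra $(A,\circ)$ is a vector space with a bilinear operation $\circ$ such that $(a\circ b)\circ c-a\circ(b\circ c)=(b\circ a)\circ c-b\circ(a\circ c)$ and $(a\circ b)\circ c=(a\circ c)\circ b$ for all $a,b,c\in A$. Put $a\star b:=a\circ b+b\circ a$. A quadratic Novikov algebra $(A,\circ,B(\cdot,\cdot))$ is a Novikov algebra with a nondegenerate symmetric bilinear form $B:A\times A\to\mathbf{k}$ such that $B(a\circ b,c)=-B(b,a\star c)$ for all $a,b,c\in A$. An ideal $I$ of $(A,\circ,B(\cdot,\cdot))$ is a subspace with $I\circ A\subset I$ and $A\circ I\subset I$; it is nondegenerate if the restriction of $B$ to $I$ is nondegenerate (the zero ideal counts as nondegenerate). In (2), ''nontrivial'' means different from $0$ and from $A_i$. *)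

(* Defs.v *)
From mathcomp Require Import all_boot all_order all_algebra.

Set Implicit Arguments.
Unset Strict Implicit.
Unset Printing Implicit Defensive.

Import GRing.Theory.
Local Open Scope ring_scope.

Section QuadraticNovikov.

Variables (k : fieldType) (A : vectType k).
Variables (mul : {bilinear A -> A -> A}) (B : {symmetric A}).

Definition novikov : Prop :=
  (forall a b c,
     mul (mul a b) c - mul a (mul b c) = mul (mul b a) c - mul b (mul a c)) /\
  (forall a b c, mul (mul a b) c = mul (mul a c) b).

Definition star (a b : A) : A := mul a b + mul b a.

Definition quadratic_novikov : Prop :=
  [/\ novikov, nondegenerate B &
      forall a b c, B (mul a b) c = - B b (star a c)].

Definition is_ideal (I : {vspace A}) : Prop :=
  forall x a, x \in I -> mul x a \in I /\ mul a x \in I.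

Definition nondegenerate_on (I : {vspace A}) : Prop :=
  forall x, x \in I -> (forall y, y \in I -> B x y = 0) -> x = 0.

Definition nondegenerate_ideal (I : {vspace A}) : Prop :=
  is_ideal I /\ nondegenerate_on I.

Lemma nondegenerate_onT : nondegenerate_on fullv <-> nondegenerate B.
Proof.
split=> [Bnd | /eqP rad0 x _ Bx].
  apply/eqP/vspaceP=> x; rewrite memv0.
  apply/mem_orthovP/eqP=> [Bx | -> y _]; last by rewrite linear0l.
  by apply: Bnd (memvf x) _ => y /Bx.
by apply/eqP; rewrite -memv0 -rad0; apply/mem_orthovP=> y /Bx.
Qed.

End QuadraticNovikov.

(* Main.v *)
Require Import Defs.
From mathcomp Require Import all_boot all_order all_algebra.
From Stdlib Require Import Classical.

(* The quadratic condition forces every right multiplication to be self-adjoint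
   for B, so the orthogonal of an ideal is an ideal. A nondegenerate ideal I
   inside a nondegenerate ideal J therefore splits J into I and the orthogonal
   of I in J, and one concludes by induction on the dimension. *)

Local Open Scope ring_scope.

Import GRing.Theory.

Section OrthogonalComplement.

Set Implicit Arguments.
Unset Strict Implicit.

Variables (k : fieldType) (A : vectType k) (B : {symmetric A}).
Implicit Types U V : {vspace A}.

Lemma symmetric_formC x y : B x y = B y x.
Proof. by rewrite hermC expr0 mul1r. Qed.

Lemma orthov_addv U V : orthov B (U + V) = (orthov B U :&: orthov B V)%VS.
Proof.
apply/eqP; rewrite eqEsubv subv_cap.
have := subvv (orthov B (U + V)); rewrite orthovD => -> /=.
by rewrite orthovD capvSl capvSr.
Qed.

(** Each vector of a spanning sequence of [U] imposes one linear condition, so it lowers the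
    dimension of [V] by at most one. *)
Lemma leq_dim_orthov V U : (\dim V <= \dim (V :&: orthov B U) + \dim U)%N.
Proof.
(* [W] stays general because the induction replaces it by its intersection with the orthogonal of
   the head [u]. *)
suff dim_span s W : (\dim W <= \dim (W :&: orthov B <<s>>) + size s)%N.
  by have := dim_span (vbasis U) V; rewrite (span_basis (vbasisP U)) size_tuple.
elim: s W => [|u s IHs] W; first by rewrite span_nil orthov0 capvf addn0.
rewrite span_cons orthov_addv capvA /= addnS.
apply: leq_trans (leqSpred _) _; rewrite ltnS.
exact: leq_trans (leq_dim_orthov1 B u W) (IHs _).
Qed.

Lemma nondegenerate_on_cap U :
  nondegenerate_on B U -> (U :&: orthov B U)%VS = 0%VS.
Proof.
move=> ndU; apply/eqP; rewrite -subv0; apply/subvP=> x.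
by rewrite memv_cap memv0 => /andP[Ux /mem_orthovP oUx]; apply/eqP/ndU.
Qed.

(** The two summands meet in 0, and the bound of [leq_dim_orthov] makes their dimensions add up to
    at least that of [V]. *)
Lemma orthov_splitting U V :
  nondegenerate_on B U -> (U <= V)%VS -> (U + (V :&: orthov B U))%VS = V.
Proof.
move=> ndU sUV; apply/eqP; rewrite eqEdim subv_add sUV capvSl /=.
rewrite dimv_disjoint_sum 1?addnC ?leq_dim_orthov //.
by rewrite (capvC V) capvA nondegenerate_on_cap // cap0v.
Qed.

(** By the splitting of [V], a vector of the complement that is orthogonal to the complement is
    orthogonal to all of [V]. *)
Lemma nondegenerate_on_orthov U V :
    nondegenerate_on B U -> nondegenerate_on B V -> (U <= V)%VS ->
  nondegenerate_on B (V :&: orthov B U).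
Proof.
move=> ndU ndV sUV x /[!memv_cap] /andP[Vx oUx] ox; apply: ndV => // y.
rewrite -{1}(orthov_splitting ndU sUV) => /memv_addP[u Uu [v VUv ->]].
by rewrite linearDr /= (mem_orthovP oUx) // ox // addr0.
Qed.

(** Pairing a vanishing sum with a vector of [U_ i] kills every term but the [i]-th, which
    nondegeneracy then forces to be 0. *)
Lemma directv_orthogonal (I : finType) (U_ : I -> {vspace A}) :
    (forall i, nondegenerate_on B (U_ i)) ->
    (forall i j, i != j -> (U_ i <= orthov B (U_ j))%VS) ->
  directv (\sum_i U_ i).
Proof.
move=> ndU oU; apply/directv_sum_independent => u Uu sum0 i _.
apply: (ndU i) => [|y Uy]; first exact: Uu.
rewrite -(linear0l B y) -sum0 linear_sumlz (bigD1 i) //= big1 ?addr0 // => j neq_ji.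
exact: (orthovP (oU j i neq_ji)) (Uu j isT) Uy.
Qed.

End OrthogonalComplement.

Section QuadraticNovikovIdeals.

Set Implicit Arguments.
Unset Strict Implicit.

Variables (k : fieldType) (A : vectType k).
Variables (mul : {bilinear A -> A -> A}) (B : {symmetric A}).
Hypothesis quadA : forall a b c, B (mul a b) c = - B b (star mul a c).
Implicit Types I J : {vspace A}.

(* Adding B (mul b c) a + B (mul b a) c to either side gives 0. *)
Lemma quadratic_right_mul_adjoint a b c : B (mul a b) c = B a (mul c b).
Proof.
have Ba : B (mul b a) c + B a (mul c b) = - B a (mul b c).
  by rewrite quadA linearDr /= opprD addrNK.
have Bc : B (mul b c) a + B c (mul a b) = - B c (mul b a).
  by rewrite quadA linearDr /= opprD addrNK.
rewrite symmetric_formC; apply: (addrI (B (mul b c) a + B (mul b a) c)).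
rewrite addrAC Bc -addrA Ba.
by rewrite (symmetric_formC B c) (symmetric_formC B a) addrC subrr subrr.
Qed.

(** Multiplication by [a] on either side of [x] moves across [B] to the other argument:
    [B (mul x a) y = B x (mul y a)] and [B (mul a x) y = - B x (star mul a y)], and both new
    arguments lie in [I]. *)
Lemma is_ideal_orthov I : is_ideal mul I -> is_ideal mul (orthov B I).
Proof.
move=> idI x a /mem_orthovP oIx; split; apply/mem_orthovP=> y Iy.
  by rewrite quadratic_right_mul_adjoint oIx //; case: (idI y a Iy).
have [Iya Iay] := idI y a Iy.
by rewrite quadA oIx ?oppr0 // memvD.
Qed.

Lemma nondegenerate_ideal_orthov I J :
    nondegenerate_ideal mul B I -> nondegenerate_ideal mul B J -> (I <= J)%VS ->
  nondegenerate_ideal mul B (J :&: orthov B I).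
Proof.
move=> [idI ndI] [idJ ndJ] sIJ; split; last exact: nondegenerate_on_orthov.
move=> x a /[!memv_cap] /andP[Jx oIx].
have [-> ->] := idJ x a Jx.
by have [-> ->] := is_ideal_orthov idI a oIx.
Qed.

Definition orthogonally_indecomposable J : Prop :=
  forall I, (I <= J)%VS -> nondegenerate_ideal mul B I -> I = 0%VS \/ I = J.

(** A sequence, unlike an indexed family, lets the decompositions of [I] and of its complement be
    concatenated. It is nonempty even for [J = 0], which is indecomposable and gives [[:: 0]]. *)
Lemma orthogonal_decomposition J :
    nondegenerate_ideal mul B J ->
  exists s : seq {vspace A},
    [/\ s != [::], (\sum_(U <- s) U)%VS = J,
        pairwise (fun U V => (U <= orthov B V)%VS) s
      & forall U, U \in s ->
          nondegenerate_ideal mul B U /\ orthogonally_indecomposable U].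
Proof.
have [n] := ubnP (\dim J); elim: n J => // n IHn J /ltnSE leJn ndJ.
have [indJ | ] := classic (orthogonally_indecomposable J).
  exists [:: J]; split=> //; first by rewrite big_seq1.
  by move=> U /[!inE] /eqP->.
move/not_all_ex_not=> [I nI].
have [sIJ nI'] := imply_to_and _ _ nI.
have [ndI /not_or_and[/eqP nzI /eqP neqIJ]] := imply_to_and _ _ nI'.
set K := (J :&: orthov B I)%VS.
have ndK : nondegenerate_ideal mul B K by exact: nondegenerate_ideal_orthov.
have defJ : (I + K)%VS = J := orthov_splitting ndI.2 sIJ.
have dimJ : (\dim I + \dim K)%N = \dim J.
  rewrite -defJ dimv_disjoint_sum // /K (capvC J) capvA nondegenerate_on_cap ?cap0v //.
  exact: ndI.2.
have ltIJ : (\dim I < \dim J)%N.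
  rewrite ltn_neqAle dimvS // andbT; apply: contra neqIJ => /eqP eq_dim.
  by rewrite eqEdim sIJ eq_dim /=.
(* The complement is smaller because [I] is nonzero. *)
have ltKJ : (\dim K < \dim J)%N by rewrite -dimJ -[ltnLHS]add0n ltn_add2r lt0n dimv_eq0.
have [s [s0 sums os Ps]] := IHn I (leq_trans ltIJ leJn) ndI.
have [t [_ sumt ot Pt]] := IHn K (leq_trans ltKJ leJn) ndK.
exists (s ++ t); split.
- by case: s s0 {sums os Ps}.
- by rewrite big_cat sums sumt.
(* Cross terms: [U] lies in [I] and [V] in [K], hence in the orthogonal of [I]. *)
- rewrite pairwise_cat os ot !andbT; apply/allrelP=> U V sU tV.
  have sub_sum (r : seq {vspace A}) W : W \in r -> (W <= \sum_(U <- r) U)%VS.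
    by move=> rW; rewrite (big_rem W) ?addvSl.
  have sUI : (U <= I)%VS by rewrite -sums sub_sum.
  have sVK : (V <= orthov B I)%VS.
    by apply: subv_trans (capvSr J _); rewrite -/K -sumt sub_sum.
  by apply: subv_trans sUI _; rewrite orthov_sym.
- by move=> U /[!mem_cat] /orP[/Ps|/Pt].
Qed.

End QuadraticNovikovIdeals.

Theorem theorem2p16 (k : fieldType) (char0 : [pchar k] =i pred0)
    (A : vectType k) (mul : {bilinear A -> A -> A}) (B : {symmetric A})
    (quadA : quadratic_novikov mul B) :
  exists r : nat, (0 < r)%N /\
  exists A_ : 'I_r -> {vspace A},
    [/\ (\sum_(i < r) A_ i)%VS = fullv /\ directv (\sum_(i < r) A_ i),
        forall i, nondegenerate_ideal mul B (A_ i),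
        forall i (I : {vspace A}),
          (I <= A_ i)%VS -> nondegenerate_ideal mul B I ->
          I = 0%VS \/ I = A_ i
      & forall i j, i != j ->
          forall x y, x \in A_ i -> y \in A_ j -> B x y = 0].
Proof.
have [_ ndB qB] := quadA.
have ndT : nondegenerate_ideal mul B fullv.
  by split; [move=> x a _; rewrite !memvf | apply/nondegenerate_onT].
have [s [s0 sums os Ps]] := orthogonal_decomposition qB ndT.
exists (size s); split; first by rewrite lt0n size_eq0.
exists (tnth (in_tuple s)).
have Pi i := Ps _ (mem_tnth i (in_tuple s)).
have oi i j : i != j -> (tnth (in_tuple s) i <= orthov B (tnth (in_tuple s) j))%VS.
  (* [pairwise] only compares earlier entries with later ones; the symmetry of orthogonality covers
     the other order. *)
  wlog lt_ij : i j / (i < j)%N => [IH neq_ij|_].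
    have := neq_ij; rewrite -val_eqE /= neq_ltn => /orP[]lt; first exact: IH.
    by rewrite orthov_sym IH // eq_sym.
  by rewrite !(tnth_nth 0%VS); apply: (pairwiseP 0%VS os); rewrite ?inE.
split; first (split; first by rewrite -sums big_tnth).
- by apply: (directv_orthogonal (B := B)) => // i; case: (Pi i) => -[].
- by move=> i; case: (Pi i).
- by move=> i; case: (Pi i).
- by move=> i j /oi /orthovP oij x y; apply: oij.
Qed.
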